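(* Let $N$ be a smooth manifold equipped with a Kähler structure $(j,g)$. On $TN$ consider the metrics $$G(\bar X,\bar Y)=g(\Pi\bar X,K\bar Y)+g(K\bar X,\Pi\bar Y),\qquad \mathbb{G}(\bar X,\bar Y)=g(K\bar X,j\Pi\bar Y)-g(\Pi\bar X,jK\bar Y).$$ Then $G$ and $\mathbb{G}$ are isometric, i.e. there is a diffeomorphism $f:TN\to TN$ with $f^*G=\mathbb{G}$.
   Context: Let $D$ be the Levi-Civita connection of $g$ and $\pi:TN\to N$ the canonical projection. For $\bar X\in T_{(p,V)}TN$ put $\Pi\bar X=d\pi(\bar X)\in T_pN$, and if $\bar X=a'(0)$ with $a(t)=(p(t),V(t))$ put $K\bar X=(D_{p'}V)(0)\in T_pN$ (covariant derivative along $p(t)$; for a vertical vector the ordinary derivative in the fibre). The map $\bar X\mapsto(\Pi\bar X,K\bar X)$ is an isomorphism $T_{(p,V)}TN\cong T_pN\oplus T_pN$. Here $j$ is the ($g$-orthogonal, $D$-parallel) complex structure of $N$. *)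

(* Defs.v *)
From HB Require Import structures.
From mathcomp Require Import all_boot all_order all_algebra.
From mathcomp Require Import all_classical all_reals all_analysis.

Set Implicit Arguments.
Unset Strict Implicit.
Unset Printing Implicit Defensive.
Import Order.TTheory GRing.Theory Num.Theory.
Import numFieldNormedType.Exports.
Local Open Scope classical_set_scope.
Local Open Scope ring_scope.

Section Ck.
Variable R : realType.
Implicit Types V W : normedModType R.

(* Stated for abstract V, W so that instances at matrices share one normed
   structure. *)
Definition differential V W (f : V -> W) (x : V) : V -> W := 'd f x.

(* C^k on the open set U, for V finite dimensional. *)
Fixpoint Ck V W (k : nat) (U : set V) (f : V -> W) : Prop :=
  match k with
  | 0 => forall x, U x -> {for x, continuous f}
  | k'.+1 => (forall x, U x -> differentiable f x) /\
             (forall v, Ck k' U ('D_v f))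
  end.

Definition smooth_on V W (U : set V) (f : V -> W) := forall k, Ck k U f.

Definition smooth_at V W (f : V -> W) (x : V) :=
  exists U : set V, [/\ open U, U x & smooth_on U f].

Lemma near_eq_is_diff V W (f g : V -> W) (x : V) :
  (\near x, f x = g x) -> differentiable f x ->
  differentiable g x /\ differential g x = differential f x.
Proof.
move=> fg df.
have key : g \o shift x = cst (g x) + 'd f x +o_ 0 id.
  have /eqaddoP e : f \o shift x = cst (f x) + 'd f x +o_ 0 id.
    exact: diff_locally.
  apply/eqaddoP => eps eps0.
  have fg0 : \forall y \near (0 : V), f (y + x) = g (y + x).
    have := fg; rewrite (near_shift 0) /=; apply: filterS => y /=.
    by rewrite subr0.
  apply: filterS2 fg0 (e _ eps0) => y fgy ey.
  change (`|g (y + x) - (g x + 'd f x y)| <= eps * `|y|).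
  by rewrite -fgy -(nbhs_singleton fg); exact: ey.
have c : continuous ('d f x) by exact: diff_continuous.
have u : 'd g x = 'd f x :> (V -> W) by exact: diff_unique.
by split=> //; apply/diff_locallyP; rewrite u.
Qed.

Lemma differential_comp V W W' (f : V -> W) (g : W -> W') (x : V) :
  differentiable f x -> differentiable g (f x) ->
  differential (g \o f) x = differential g (f x) \o differential f x.
Proof. exact: diff_comp. Qed.

Lemma differential_id V (x : V) : differential id x = id.
Proof. by rewrite /differential diff_val. Qed.

Lemma near_open V (U : set V) (P : V -> Prop) x :
  open U -> (forall y, U y -> P y) -> U x -> \forall y \near x, P y.
Proof. by move=> oU UP Ux; apply: filterS UP _; exact: open_nbhs_nbhs. Qed.

Lemma Ck_eq V W k (U : set V) (f g : V -> W) :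
  open U -> (forall x, U x -> f x = g x) -> Ck k U f -> Ck k U g.
Proof.
move=> oU; elim: k f g => [|k IH] f g fg /=.
  move=> cf x Ux; change (g @ x --> g x).
  rewrite -(fg _ Ux); apply: cvg_trans (cf x Ux).
  by apply: near_eq_cvg; exact: (near_open oU fg Ux).
move=> [df Df]; split=> [x Ux|v].
  by have [] := near_eq_is_diff (near_open oU fg Ux) (df x Ux).
apply: IH (Df v) => x Ux; apply: near_eq_derive; exact: (near_open oU fg Ux).
Qed.

Lemma CkD V W k (U : set V) (f g : V -> W) :
  open U -> Ck k U f -> Ck k U g -> Ck k U (fun x => f x + g x).
Proof.
move=> oU; elim: k f g => [|k IH] f g /=.
  by move=> cf cg x Ux; apply: continuousD; [exact: cf|exact: cg].
move=> [df Df] [dg Dg]; split=> [x Ux|v].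
  by apply: differentiableD; [exact: df|exact: dg].
apply: Ck_eq (IH _ _ (Df v) (Dg v)) => // x Ux.
by rewrite -deriveD //; apply: diff_derivable; [exact: df|exact: dg].
Qed.

Lemma Ck_cst V W k (U : set V) (a : W) : Ck k U (fun _ => a).
Proof.
elim: k a => [|k IH] a /=; first by move=> x _; exact: cvg_cst.
split=> [x _|v]; first exact: differentiable_cst.
have -> : 'D_v (fun=> a) = fun _ : V => 0 :> W.
  by apply/funext => x; rewrite derive_cst.
exact: IH.
Qed.

Lemma Ck_pred V W k (U : set V) (f : V -> W) : Ck k.+1 U f -> Ck k U f.
Proof.
elim: k f => [|k IH] f [df Df].
  by move=> x Ux; apply: differentiable_continuous; exact: df.
by split=> // v; apply: IH.
Qed.

Lemma Ck_sub V W k (U U' : set V) (f : V -> W) :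
  U' `<=` U -> Ck k U f -> Ck k U' f.
Proof.
move=> sU; elim: k f => [|k IH] f; first by move=> cf x /sU; exact: cf.
move=> [df Df]; split=> [x /sU Ux|v]; first exact: df.
exact: (IH _ (Df v)).
Qed.

Lemma Ck_id V k (U : set V) : Ck k U id.
Proof.
case: k => [|k]; first by move=> x _; exact: cvg_id.
split=> [x _|v]; first exact: ex_diff.
have -> : 'D_v id = fun _ : V => v by apply/funext => x; rewrite derive_id.
exact: Ck_cst.
Qed.

Lemma Ck_sum V W n k (U : set V) (f : 'I_n -> V -> W) :
  open U -> (forall i, Ck k U (f i)) -> Ck k U (fun x => \sum_i f i x).
Proof.
move=> oU Hf; rewrite -fct_sumE; elim/big_ind: _ => [|g h|//].
  exact: Ck_cst.
exact: CkD.
Qed.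

Lemma CkM V k (U : set V) (f g : V -> R) :
  open U -> Ck k U f -> Ck k U g -> Ck k U (fun x => f x * g x).
Proof.
move=> oU; elim: k f g => [|k IH] f g.
  by move=> cf cg x Ux; apply: continuousM; [exact: cf|exact: cg].
move=> hf hg; have [df Df] := hf; have [dg Dg] := hg; split=> [x Ux|v].
  by apply: differentiableM; [exact: df|exact: dg].
apply: (@Ck_eq _ _ _ _ (fun x => f x * 'D_v g x + g x * 'D_v f x)) => //.
  by move=> x Ux; rewrite -deriveM //; apply: diff_derivable;
    [exact: df|exact: dg].
apply: CkD => //; apply: IH => //; try exact: Dg; try exact: Df.
  exact: (Ck_pred hf).
exact: (Ck_pred hg).
Qed.

Lemma Ck_lin V W W' k (U : set V) (f : V -> W) (L : {linear W -> W'}) :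
  open U -> continuous L -> Ck k U f -> Ck k U (L \o f).
Proof.
move=> oU cL; elim: k f => [|k IH] f.
  by move=> cf x Ux; apply: continuous_comp; [exact: cf|exact: cL].
move=> [df Df]; have dL y : differentiable L y by exact: linear_differentiable.
split=> [x Ux|v]; first by apply: differentiable_comp => //; exact: df.
apply: Ck_eq (IH _ (Df v)) => // x Ux /=.
have dfx := df x Ux; rewrite (deriveE _ dfx) deriveE; last first.
  exact: differentiable_comp.
by rewrite (diff_comp dfx (dL _)) /= (diff_lin _ cL).
Qed.

Lemma Ck_comp_lin V V' W k (U : set V) (f : V -> W) (L : {linear V' -> V}) :
  continuous L -> Ck k U f -> Ck k (L @^-1` U) (f \o L).
Proof.
move=> cL; elim: k f => [|k IH] f.
  move=> cf x Ux; apply: continuous_comp; first exact: cL.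
  exact: (cf (L x) Ux).
move=> [df Df]; split=> [x Ux|v].
  apply: differentiable_comp; last exact: (df (L x) Ux).
  exact: linear_differentiable.
have h := IH _ (Df (L v)).
suff -> : 'D_v (f \o L) = 'D_(L v) f \o L by [].
apply/funext => x; rewrite /derive.
set F := (X in X @ _); set G := (X in _ = lim (X @ _)).
suff -> : F = G by [].
by apply/funext => t; rewrite /F /G /= [L (_ + _)]linearD linearZZ.
Qed.

Lemma linear_rV_continuous W n (L : {linear 'rV[R]_n -> W}) : continuous L.
Proof.
have -> : L = (fun x => \sum_(k < n) x 0 k *: L (delta_mx 0 k)) :> (_ -> _).
  apply/funext => x; rewrite [in LHS](row_sum_delta x) linear_sum.
  by apply: eq_bigr => k _; rewrite linearZ.
suff h : Ck 0 setT (fun x : 'rV[R]_n => \sum_k x 0 k *: L (delta_mx 0 k)).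
  by move=> x; exact: h.
apply: Ck_sum => [|k x _]; first exact: openT.
by apply: continuousZr_tmp; exact: coord_continuous.
Qed.

Lemma Ck_lin_fun V W W' k (U : set V) (f : V -> W) (L : W -> W') :
  linear L -> open U -> continuous L -> Ck k U f -> Ck k U (fun x => L (f x)).
Proof.
move=> linL oU cL hf.
pose M := GRing.isLinear.Build _ _ _ _ L linL.
pose L' : {linear _ -> _} := HB.pack L M.
exact: (@Ck_lin _ _ _ _ _ _ L').
Qed.

Lemma Ck_coord V n k (U : set V) (f : V -> 'rV[R]_n) (j : 'I_n) :
  open U -> Ck k U f -> Ck k U (fun x => f x 0 j : R).
Proof.
move=> oU; apply: (@Ck_lin_fun _ _ _ _ _ _ (fun y : 'rV[R]_n => y 0 j)) => //.
  by move=> a x y; rewrite !mxE.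
exact: coord_continuous.
Qed.

Lemma Ck_scalel V W k (U : set V) (f : V -> R) (w : W) :
  open U -> Ck k U f -> Ck k U (fun x => f x *: w).
Proof.
move=> oU; apply: (@Ck_lin_fun _ _ _ _ _ _ (fun y : R => y *: w)) => //.
  by move=> a x y; rewrite scalerDl scalerA.
exact: scalel_continuous.
Qed.

Lemma Ck_row_mx V n m k (U : set V) (f : V -> 'rV[R]_n) (g : V -> 'rV[R]_m) :
  open U -> Ck k U f -> Ck k U g -> Ck k U (fun x => row_mx (f x) (g x)).
Proof.
move=> oU hf hg.
apply: (@Ck_eq _ _ _ _ (fun x => row_mx (f x) 0 + row_mx 0 (g x))) => //.
  by move=> x _; rewrite add_row_mx addr0 add0r.
have l1 : linear (fun y : 'rV[R]_n => row_mx y (0 : 'rV[R]_m)).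
  by move=> a x y; rewrite scale_row_mx add_row_mx scaler0 addr0.
have l2 : linear (fun y : 'rV[R]_m => row_mx (0 : 'rV[R]_n) y).
  by move=> a x y; rewrite scale_row_mx add_row_mx scaler0 addr0.
pose M1 := GRing.isLinear.Build _ _ _ _ _ l1.
pose M2 := GRing.isLinear.Build _ _ _ _ _ l2.
pose L1 : {linear _ -> _} := HB.pack (fun y : 'rV[R]_n => row_mx y 0) M1.
pose L2 : {linear _ -> _} := HB.pack (fun y : 'rV[R]_m => row_mx 0 y) M2.
apply: CkD => //.
- exact: (@Ck_lin _ _ _ k U f L1 oU (@linear_rV_continuous _ _ _)).
- exact: (@Ck_lin _ _ _ k U g L2 oU (@linear_rV_continuous _ _ _)).
Qed.

Lemma Ck_tangent n m k (U : set 'rV[R]_n) (f : 'rV[R]_n -> 'rV[R]_m) :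
  open U -> Ck k.+1 U f ->
  Ck k (lsubmx @^-1` U : set 'rV[R]_(n + n))
     (fun z => row_mx (f (lsubmx z)) (differential f (lsubmx z) (rsubmx z))).
Proof.
move=> oU hf; have [df Df] := hf.
set S := (X in Ck _ X _).
have oS : open S by apply: open_comp => // x _; exact: continuous_lsubmx.
have cl W (h : 'rV[R]_n -> W) : Ck k U h -> Ck k S (fun z => h (lsubmx z)).
  exact: (@Ck_comp_lin _ _ _ k U h lsubmx (@continuous_lsubmx _ _ _ _)).
apply: Ck_row_mx => //; first by apply: cl; exact: Ck_pred.
apply: (@Ck_eq _ _ _ _ (fun z => \sum_(i < n) \sum_(j < m)
    (rsubmx z 0 i * 'D_(delta_mx 0 i) f (lsubmx z) 0 j) *: delta_mx 0 j))
  => // [z Sz|].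
  rewrite /differential [in RHS](row_sum_delta (rsubmx z)) linear_sum; apply: eq_bigr => i _.
  rewrite linearZZ -(deriveE _ (df _ Sz)).
  rewrite [in RHS](row_sum_delta ('D_(delta_mx 0 i) f (lsubmx z))) scaler_sumr.
  by apply: eq_bigr => j _; rewrite scalerA.
apply: Ck_sum => // i; apply: Ck_sum => // j; apply: Ck_scalel => //.
apply: CkM => //; apply: Ck_coord => //.
  have idT := @Ck_id 'rV[R]_n k setT.
  have := @Ck_comp_lin _ _ _ k setT id rsubmx (@continuous_rsubmx _ 1 n n) idT.
  exact: Ck_sub.
exact: (cl _ ('D_(delta_mx 0 i) f) (Df _)).
Qed.

End Ck.

(* A space with a (not necessarily maximal) smooth atlas.  [chart i] and
   [chartV i] are total functions, mutually inverse between [chart_dom i] and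
   its image and arbitrary elsewhere.  [chart_at p] is a chosen chart around p. *)
Record smoothSpace (R : realType) (n : nat) := SmoothSpace {
  carrier :> topologicalType;
  chart_index : Type;
  chart_dom : chart_index -> set carrier;
  chart : chart_index -> carrier -> 'rV[R]_n;
  chartV : chart_index -> 'rV[R]_n -> carrier;
  chart_at : carrier -> chart_index;
  chart_dom_at : forall p, chart_dom (chart_at p) p;
  chart_dom_open : forall i, open (chart_dom i);
  chart_img_open : forall i, open (chart i @` chart_dom i);
  chartK : forall i p, chart_dom i p -> chartV i (chart i p) = p;
  chart_continuous : forall i p, chart_dom i p -> {for p, continuous (chart i)};
  chartV_continuous : forall i x, (chart i @` chart_dom i) x ->
    {for x, continuous (chartV i)};
  chart_smooth : forall i j,
    smooth_on (chart i @` (chart_dom i `&` chart_dom j)) (chart j \o chartV i)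
}.

Definition is_manifold (R : realType) (n : nat) (M : smoothSpace R n) :=
  hausdorff_space M /\ @second_countable M.

Section TangentBundle.
Variables (R : realType) (n : nat) (M : smoothSpace R n).
Implicit Types (p : M) (i j k : chart_index M).

(* T_pM is presented by coordinates in the chart [chart_at p], which may jump
   with p: only [tcoord i] gives coordinates comparable at different points.
   [tchange i j p] is the change of coordinates at p from chart i to chart j. *)
Definition tspace (p : M) : lmodType R := 'rV[R]_n.

Definition tchange i j p (x : 'rV[R]_n) : 'rV[R]_n :=
  differential (chart j \o chartV i) (chart i p) x.

Definition tcoord i p (v : tspace p) : 'rV[R]_n := tchange (chart_at p) i p v.

Definition tvec i p (x : 'rV[R]_n) : tspace p := tchange i (chart_at p) p x.

Record tangent := TPoint { base : M; vec : tspace base }.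

Lemma chartVK i x : (chart i @` chart_dom i) x -> chart i (chartV i x) = x.
Proof. by move=> [p dp <-]; rewrite chartK. Qed.

Lemma chartV_dom i x : (chart i @` chart_dom i) x -> chart_dom i (chartV i x).
Proof. by move=> [p dp <-]; rewrite chartK. Qed.

Lemma chart_img_preimage i (A : set M) : open A ->
  open (chart i @` chart_dom i `&` chartV i @^-1` A).
Proof.
move=> oA; rewrite openE => x [ix Ax]; apply: filterI.
  by apply: open_nbhs_nbhs; split=> //; exact: chart_img_open.
by apply: (chartV_continuous ix); exact: open_nbhs_nbhs.
Qed.

Lemma chart_img_setI i (A : set M) :
  chart i @` (chart_dom i `&` A) = chart i @` chart_dom i `&` chartV i @^-1` A.
Proof.
apply/seteqP; split=> [_ [p [dp Ap] <-]|x [ix Ax]].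
  by split; [exists p|rewrite /= chartK].
by exists (chartV i x); [split=> //; exact: chartV_dom|exact: chartVK].
Qed.

Lemma transition_open i j : open (chart i @` (chart_dom i `&` chart_dom j)).
Proof. by rewrite chart_img_setI; apply/chart_img_preimage/chart_dom_open. Qed.

Lemma transition_differentiable i j p : chart_dom i p -> chart_dom j p ->
  differentiable (chart j \o chartV i) (chart i p).
Proof. by move=> ip jp; have [+ _] := @chart_smooth _ _ M i j 1; apply; exists p. Qed.

Lemma tchange_comp i j k p x :
  chart_dom i p -> chart_dom j p -> chart_dom k p ->
  tchange j k p (tchange i j p x) = tchange i k p x.
Proof.
move=> ip jp kp; rewrite /tchange.
have d1 := transition_differentiable ip jp.
have d2 := transition_differentiable jp kp.
have e : (chart j \o chartV i) (chart i p) = chart j p by rewrite /= chartK.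
rewrite -e in d2 *; have dc := differential_comp d1 d2.
have ji : (chart i @` (chart_dom i `&` chart_dom j)) (chart i p) by exists p.
have e2 : \forall y \near chart i p,
    ((chart k \o chartV j) \o (chart j \o chartV i)) y = (chart k \o chartV i) y.
  apply: near_open (@transition_open i j) _ ji => _ [q [iq jq] <-] /=.
  by rewrite !chartK.
have dd := differentiable_comp d1 d2.
have [_ E] := near_eq_is_diff e2 dd.
by rewrite E dc.
Qed.

Lemma tchange_id i p x : chart_dom i p -> tchange i i p x = x.
Proof.
move=> ip; rewrite /tchange.
have ii : (chart i @` chart_dom i) (chart i p) by exists p.
have e : \forall y \near chart i p, id y = (chart i \o chartV i) y.
  apply: near_open (@chart_img_open _ _ M i) _ ii => _ [q iq <-] /=.
  by rewrite chartK.
have [_ ->] := near_eq_is_diff e (@ex_diff _ _ _ _ _ _ _ (is_diff_id _)).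
by rewrite differential_id.
Qed.

(* The charts of TM are the charts of M with their fibre coordinates; the
   topology is the one they generate. *)
Definition tangent_dom i : set tangent := base @^-1` chart_dom i.

Definition tangent_chart i (u : tangent) : 'rV[R]_(n + n) :=
  row_mx (chart i (base u)) (tcoord i (vec u)).

Definition tangent_chartV i (z : 'rV[R]_(n + n)) : tangent :=
  TPoint (tvec i (chartV i (lsubmx z)) (rsubmx z)).

Definition tangent_img i : set 'rV[R]_(n + n) :=
  lsubmx @^-1` (chart i @` chart_dom i).

Lemma tangent_chartK i u : tangent_dom i u ->
  tangent_chartV i (tangent_chart i u) = u.
Proof.
case: u => p v ip; rewrite /tangent_chartV /tangent_chart row_mxKl row_mxKr /=.
rewrite chartK // /tcoord /tvec tchange_comp ?tchange_id //; exact: chart_dom_at.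
Qed.

Lemma tangent_chartVK i z : tangent_img i z ->
  tangent_chart i (tangent_chartV i z) = z.
Proof.
rewrite /tangent_chartV /tangent_chart /= => iz.
have dz := chartV_dom iz; rewrite chartVK // /tcoord /tvec.
by rewrite tchange_comp ?tchange_id ?hsubmxK //; exact: chart_dom_at.
Qed.

Lemma tangent_chart_img i : tangent_chart i @` tangent_dom i = tangent_img i.
Proof.
apply/seteqP; split=> [_ [u iu <-]|z iz].
  by rewrite /tangent_img /tangent_chart /= row_mxKl; exists (base u).
by exists (tangent_chartV i z); [exact: chartV_dom|exact: tangent_chartVK].
Qed.

Definition tangent_open (A : set tangent) :=
  forall i, open (tangent_img i `&` tangent_chartV i @^-1` A).

Lemma tangent_img_open i : open (tangent_img i).
Proof.
by apply: open_comp => [z _|]; [exact: continuous_lsubmx|exact: chart_img_open].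
Qed.

Lemma tangent_openT : tangent_open setT.
Proof. by move=> i; rewrite preimage_setT setIT; exact: tangent_img_open. Qed.

Lemma tangent_openI : setI_closed tangent_open.
Proof.
move=> A B oA oB i; rewrite preimage_setI -[X in X `&` _]setIid setIACA.
exact: openI.
Qed.

Lemma tangent_open_bigcup (I : Type) (f : I -> set tangent) :
  (forall a, tangent_open (f a)) -> tangent_open (\bigcup_a f a).
Proof.
move=> of_ i; rewrite preimage_bigcup setI_bigcupr.
by apply: bigcup_open => j _; exact: of_.
Qed.

HB.instance Definition _ := gen_eqMixin tangent.
HB.instance Definition _ := gen_choiceMixin tangent.
HB.instance Definition _ := isOpenTopological.Build tangent
  tangent_openT tangent_openI tangent_open_bigcup.

Lemma tangent_transition i j z :
  (chart i @` (chart_dom i `&` chart_dom j)) (lsubmx z) ->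
  tangent_chart j (tangent_chartV i z) =
  row_mx ((chart j \o chartV i) (lsubmx z))
         (differential (chart j \o chartV i) (lsubmx z) (rsubmx z)).
Proof.
move=> [p [ip jp] e]; rewrite /tangent_chart /tangent_chartV /= -e chartK //.
by rewrite /tcoord /tvec tchange_comp //; exact: chart_dom_at.
Qed.

Lemma tangent_transition_smooth i j :
  smooth_on (lsubmx @^-1` (chart i @` (chart_dom i `&` chart_dom j)))
    (tangent_chart j \o tangent_chartV i).
Proof.
move=> k.
have := Ck_tangent (@transition_open i j) (@chart_smooth _ _ M i j k.+1).
apply: Ck_eq => [|z iz]; last by rewrite /= tangent_transition.
apply: open_comp => [z _|]; [exact: continuous_lsubmx|exact: transition_open].
Qed.

Lemma tangent_dom_img i j :
  tangent_chart i @` (tangent_dom i `&` tangent_dom j) =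
  lsubmx @^-1` (chart i @` (chart_dom i `&` chart_dom j)).
Proof.
apply/seteqP; split=> [_ [u [iu ju] <-]|z /= [p [ip jp] e]].
  by rewrite /tangent_chart /= row_mxKl; exists (base u).
exists (tangent_chartV i z); last by apply: tangent_chartVK; exists p.
by split; rewrite /tangent_dom /= -e chartK.
Qed.

Lemma tangent_dom_open i : open (tangent_dom i).
Proof.
move=> j; suff -> : tangent_img j `&` tangent_chartV j @^-1` tangent_dom i =
   lsubmx @^-1` (chart j @` (chart_dom j `&` chart_dom i)).
  by apply: open_comp => [z _|];
    [exact: continuous_lsubmx|exact: transition_open].
by rewrite chart_img_setI.
Qed.

Lemma tangent_chartV_continuous i z : (tangent_chart i @` tangent_dom i) z ->
  {for z, continuous (tangent_chartV i)}.
Proof.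
rewrite tangent_chart_img => iz A; rewrite nbhsE => -[B [oB Bz] BA].
have h : (tangent_img i `&` tangent_chartV i @^-1` B) z by [].
apply: filterS (open_nbhs_nbhs (conj (oB i) h)) => y [_ By]; exact: BA.
Qed.

Lemma tangent_chart_continuous i u : tangent_dom i u ->
  {for u, continuous (tangent_chart i)}.
Proof.
move=> iu A; rewrite nbhsE => -[B [oB Bz] BA].
have h : open (tangent_dom i `&` tangent_chart i @^-1` B).
  move=> j; set T := (X in open X).
  pose S := lsubmx @^-1` (chart j @` (chart_dom j `&` chart_dom i))
    : set 'rV[R]_(n + n).
  have -> : T = S `&` (tangent_chart i \o tangent_chartV j) @^-1` B.
    rewrite /S chart_img_setI; apply/seteqP; split=> z.
      by move=> [jz [iz Bz']].
    by move=> [[jz iz] Bz'].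
  have oS : open S.
    by apply: open_comp => [z _|];
      [exact: continuous_lsubmx|exact: transition_open].
  rewrite openE => z [Sz Bz']; apply: filterI; first exact: open_nbhs_nbhs.
  have c := @tangent_transition_smooth j i 0 z Sz.
  by apply: c; exact: open_nbhs_nbhs.
have hu : (tangent_dom i `&` tangent_chart i @^-1` B) u by [].
apply: filterS (open_nbhs_nbhs (conj h hu)) => y [_ By]; exact: BA.
Qed.

Definition tangent_bundle : smoothSpace R (n + n).
Proof.
refine (@SmoothSpace R (n + n) tangent (chart_index M) tangent_dom tangent_chart
  tangent_chartV (fun u => chart_at (base u)) (fun u => chart_dom_at (base u))
  tangent_dom_open _ tangent_chartK tangent_chart_continuous
  tangent_chartV_continuous _).
- by move=> i; rewrite tangent_chart_img; exact: tangent_img_open.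
- by move=> i j; rewrite tangent_dom_img; exact: tangent_transition_smooth.
Defined.

End TangentBundle.

Section SmoothMaps.
Variable R : realType.

(* Smoothness and differentials are read in the charts chosen at p and f p. *)
Definition smooth_map_at m n (M : smoothSpace R m) (N : smoothSpace R n)
    (f : M -> N) (p : M) :=
  {for p, continuous f} /\
  smooth_at (chart (chart_at (f p)) \o f \o chartV (chart_at p))
    (chart (chart_at p) p).

Definition smooth_fun_at n (M : smoothSpace R n) (f : M -> R) (p : M) :=
  smooth_at (f \o chartV (chart_at p)) (chart (chart_at p) p).

Definition smooth_curve_at n (M : smoothSpace R n) (a : R -> M) (t : R) :=
  {for t, continuous a} /\ smooth_at (chart (chart_at (a t)) \o a) t.

Definition mdiff m n (M : smoothSpace R m) (N : smoothSpace R n)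
    (f : M -> N) (p : M) (v : tspace p) : tspace (f p) :=
  differential (chart (chart_at (f p)) \o f \o chartV (chart_at p))
    (chart (chart_at p) p) v.

Definition deriv_along n (M : smoothSpace R n) (p : M) (v : tspace p)
    (f : M -> R) : R :=
  differential (f \o chartV (chart_at p)) (chart (chart_at p) p) v.

Definition velocity n (M : smoothSpace R n) (a : R -> M) (t : R) :
    tspace (a t) :=
  'D_1 (chart (chart_at (a t)) \o a) t.

Definition diffeomorphism m n (M : smoothSpace R m) (N : smoothSpace R n)
    (f : M -> N) :=
  exists h : N -> M, [/\ cancel f h, cancel h f,
    forall p, smooth_map_at f p & forall q, smooth_map_at h q].

Definition pullback m n (M : smoothSpace R m) (N : smoothSpace R n)
    (f : M -> N) (B : forall q : N, tspace q -> tspace q -> R)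
    (p : M) (v w : tspace p) : R :=
  B (f p) (mdiff f v) (mdiff f w).

End SmoothMaps.

Section Kaehler.
Variables (R : realType) (n : nat) (N : smoothSpace R n).

Definition vfield := forall p : N, tspace p.

Definition smooth_vfield_at (X : vfield) (p : N) :=
  smooth_map_at (fun q => TPoint (X q) : tangent_bundle N) p.

Record riemannian_metric (g : forall p : N, tspace p -> tspace p -> R) : Prop := {
  metric_linear : forall p a (u v w : tspace p),
    g p (a *: u + v) w = a * g p u w + g p v w;
  metric_sym : forall p (u v : tspace p), g p u v = g p v u;
  metric_pos : forall p (v : tspace p), v != 0 -> 0 < g p v v;
  metric_smooth : forall p (X Y : vfield),
    smooth_vfield_at X p -> smooth_vfield_at Y p ->
    smooth_fun_at (fun q => g q (X q) (Y q)) p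
}.

(* D p v Y is the covariant derivative at p of Y in the direction v.  As fields
   need only be smooth near p, the Leibniz rule forces D p v Y to depend only on
   the germ of Y at p. *)
Record connection (D : forall p : N, tspace p -> vfield -> tspace p) : Prop := {
  connection_linear : forall p a (v w : tspace p) (Y : vfield),
    smooth_vfield_at Y p ->
    D p (a *: v + w) Y = a *: D p v Y + D p w Y;
  connection_add : forall p (v : tspace p) (X Y : vfield),
    smooth_vfield_at X p -> smooth_vfield_at Y p ->
    D p v (fun q => X q + Y q) = D p v X + D p v Y;
  connection_leibniz : forall p (v : tspace p) (f : N -> R) (Y : vfield),
    smooth_fun_at f p -> smooth_vfield_at Y p ->
    D p v (fun q => f q *: Y q) = deriv_along v f *: Y p + f p *: D p v Y;
  connection_smooth : forall p (X Y : vfield),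
    smooth_vfield_at X p -> smooth_vfield_at Y p ->
    smooth_vfield_at (fun q => D q (X q) Y) p
}.

(* D_X Y - D_Y X = [X, Y], both sides acting as derivations. *)
Definition torsion_free (D : forall p : N, tspace p -> vfield -> tspace p) :=
  forall p (X Y : vfield) (f : N -> R),
    smooth_vfield_at X p -> smooth_vfield_at Y p -> smooth_fun_at f p ->
    deriv_along (D p (X p) Y - D p (Y p) X) f =
    deriv_along (X p) (fun q => deriv_along (Y q) f) -
    deriv_along (Y p) (fun q => deriv_along (X q) f).

Definition metric_compatible (g : forall p : N, tspace p -> tspace p -> R)
    (D : forall p : N, tspace p -> vfield -> tspace p) :=
  forall p (v : tspace p) (X Y : vfield),
    smooth_vfield_at X p -> smooth_vfield_at Y p ->
    deriv_along v (fun q => g q (X q) (Y q)) =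
    g p (D p v X) (Y p) + g p (X p) (D p v Y).

Definition levi_civita (g : forall p : N, tspace p -> tspace p -> R)
    (D : forall p : N, tspace p -> vfield -> tspace p) :=
  [/\ connection D, torsion_free D & metric_compatible g D].

(* Integrability of j follows from kaehler_parallel, D being torsion-free. *)
Record kaehler (j : forall p : N, tspace p -> tspace p)
    (g : forall p : N, tspace p -> tspace p -> R)
    (D : forall p : N, tspace p -> vfield -> tspace p) : Prop := {
  kaehler_metric : riemannian_metric g;
  kaehler_levi_civita : levi_civita g D;
  kaehler_linear : forall p a (v w : tspace p),
    j p (a *: v + w) = a *: j p v + j p w;
  kaehler_square : forall p (v : tspace p), j p (j p v) = - v;
  kaehler_smooth : forall p (X : vfield),
    smooth_vfield_at X p -> smooth_vfield_at (fun q => j q (X q)) p;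
  kaehler_orthogonal : forall p (v w : tspace p), g p (j p v) (j p w) = g p v w;
  kaehler_parallel : forall p (v : tspace p) (X : vfield),
    smooth_vfield_at X p -> D p v (fun q => j q (X q)) = j p (D p v X)
}.

Variable D : forall p : N, tspace p -> vfield -> tspace p.

Definition frame (i : chart_index N) (k : 'I_n) : vfield :=
  fun q => tvec i q (delta_mx 0 k).

(* The covariant derivative D_(p') V at t of the field V along p, a = (p, V).  With
   (E_k) the coordinate frame at p(t) and V = \sum_k V^k E_k, it is
   \sum_k (V^k)' E_k + V^k D_(p') E_k. *)
Definition cov_deriv (a : R -> tangent_bundle N) (t : R) : tspace (base (a t)) :=
  let i := chart_at (base (a t)) in
  let V s := tcoord i (vec (a s)) in
  \sum_(k < n) ('D_1 (fun s => V s 0 k) t *: frame i k (base (a t)) +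
     V t 0 k *: D (velocity (fun s => base (a s)) t) (frame i k)).

Definition Pi_map (u : tangent_bundle N) (X : tspace u) : tspace (base u) :=
  mdiff (fun u : tangent_bundle N => base u) X.

(* K (a'(0)) = (D_(p') V)(0) for a = (p, V); this determines K since every tangent vector is
   the velocity of some curve. *)
Definition K_map (u : tangent_bundle N) (X : tspace u) : tspace (base u) :=
  xget 0 [set w : tspace (base u) | exists a : R -> tangent_bundle N,
    [/\ smooth_curve_at a 0, a 0 = u, velocity a 0 = X & cov_deriv a 0 = w]].

Variable g : forall p : N, tspace p -> tspace p -> R.
Variable j : forall p : N, tspace p -> tspace p.

Definition G_metric (u : tangent_bundle N) (X Y : tspace u) : R :=
  g (Pi_map X) (K_map Y) + g (K_map X) (Pi_map Y).

Definition GG_metric (u : tangent_bundle N) (X Y : tspace u) : R :=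
  g (K_map X) (j (Pi_map Y)) - g (Pi_map X) (j (K_map Y)).

End Kaehler.

(* Main.v *)
(* Fibrewise multiplication by -j is the required isometry f(p, V) = (p, -jV).
   More generally, let F be induced by a smooth parallel endomorphism J of the
   tangent spaces.  Then Pi dF = Pi, and K dF = J K: in a chart, with E_k the
   coordinate frame,
     K(xi, eta) = eta + sum_k V^k D_xi E_k,
     dF(xi, eta) = (xi, J eta + sum_k V^k d(J E_k)(xi)),
   and D_xi (J E_k) = J D_xi E_k turns K dF (xi, eta) into J K(xi, eta).  For
   J = -j this gives (f^* G)(X, Y) = - g(Pi X, j K Y) - g(j K X, Pi Y), and j is
   skew for g. *)
Require Import Defs.
From HB Require Import structures.
From mathcomp Require Import all_boot all_order all_algebra.
From mathcomp Require Import all_classical all_reals all_analysis.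

Set Implicit Arguments.
Unset Strict Implicit.
Unset Printing Implicit Defensive.
Import Order.TTheory GRing.Theory Num.Theory.
Import numFieldNormedType.Exports.
Local Open Scope classical_set_scope.
Local Open Scope ring_scope.

(** * Smooth germs between normed spaces and their differentials *)

Section SmoothAt.
Variable R : realType.
Implicit Types V W : normedModType R.

Lemma linear_rVE m (W : lmodType R) (L : 'rV[R]_m -> W) x :
  linear L -> L x = \sum_k x 0 k *: L (delta_mx 0 k).
Proof.
move=> lin; pose M := GRing.isLinear.Build _ _ _ _ _ lin.
pose L' : {linear _ -> _} := HB.pack L M.
change (L' x = \sum_k x 0 k *: L' (delta_mx 0 k)).
rewrite [in LHS](row_sum_delta x) linear_sum.
by apply: eq_bigr => k _; rewrite linearZ.
Qed.

Lemma smooth_at_near_eq V W (f g : V -> W) x :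
  (\near x, f x = g x) -> smooth_at f x -> smooth_at g x.
Proof.
rewrite /prop_near1 nbhsE => -[A [oA Ax] Afg] [U [oU Ux sf]].
exists (U `&` A); split=> // [|k]; first exact: openI.
have oUA : open (U `&` A) by exact: openI.
apply: (Ck_eq oUA (f := f)) => [y [_ /Afg//]|].
by apply: Ck_sub (sf k) => y [].
Qed.

Lemma smooth_at_differentiable V W (f : V -> W) x :
  smooth_at f x -> differentiable f x.
Proof. by move=> [U [_ Ux /(_ 1) [+ _]]]; exact. Qed.

Lemma smooth_at_continuous V W (f : V -> W) x :
  smooth_at f x -> {for x, continuous f}.
Proof. by move=> [U [_ Ux /(_ 0)]]; exact. Qed.

Lemma smooth_at_cst V W (a : W) (x : V) : smooth_at (fun=> a) x.
Proof. by exists setT; split=> // [|k]; [exact: openT|exact: Ck_cst]. Qed.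

Lemma smooth_at_id V (x : V) : smooth_at id x.
Proof. by exists setT; split=> // [|k]; [exact: openT|exact: Ck_id]. Qed.

(** Lifts a binary closure property of [Ck] to germs: [f] and [g] may be smooth on different
    neighbourhoods, so both are restricted to the intersection. *)
Lemma smooth_at2 V W1 W2 W (f : V -> W1) (g : V -> W2) (h : V -> W) x :
  (forall k U, open U -> Ck k U f -> Ck k U g -> Ck k U h) ->
  smooth_at f x -> smooth_at g x -> smooth_at h x.
Proof.
move=> fgh [U [oU Ux sf]] [U' [oU' Ux' sg]].
exists (U `&` U'); split=> // [|k]; first exact: openI.
by apply: fgh; [exact: openI|apply: Ck_sub (sf k) => y []
  |apply: Ck_sub (sg k) => y []].
Qed.

Lemma smooth_atD V W (f g : V -> W) x :
  smooth_at f x -> smooth_at g x -> smooth_at (fun y => f y + g y) x.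
Proof. by apply: smooth_at2 => k U oU; exact: CkD. Qed.

Lemma smooth_atM V (f g : V -> R) x :
  smooth_at f x -> smooth_at g x -> smooth_at (fun y => f y * g y) x.
Proof. by apply: smooth_at2 => k U oU; exact: CkM. Qed.

Lemma smooth_at_row_mx V n m (f : V -> 'rV[R]_n) (g : V -> 'rV[R]_m) x :
  smooth_at f x -> smooth_at g x -> smooth_at (fun y => row_mx (f y) (g y)) x.
Proof. by apply: smooth_at2 => k U oU; exact: Ck_row_mx. Qed.

Lemma smooth_at_sum V W n (f : 'I_n -> V -> W) x :
  (forall i, smooth_at (f i) x) -> smooth_at (fun y => \sum_i f i y) x.
Proof.
move=> sf; rewrite -fct_sumE; elim/big_ind: _ => [|g h|//].
  exact: smooth_at_cst.
exact: smooth_atD.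
Qed.

Lemma smooth_at_lin V W W' (f : V -> W) (L : {linear W -> W'}) x :
  continuous L -> smooth_at f x -> smooth_at (L \o f) x.
Proof.
move=> cL [U [oU Ux sf]]; exists U; split=> // k; exact: Ck_lin (sf k).
Qed.

Lemma smooth_at_comp_lin V V' W (f : V -> W) (L : {linear V' -> V}) x :
  continuous L -> smooth_at f (L x) -> smooth_at (f \o L) x.
Proof.
move=> cL [U [oU Ux sf]]; exists (L @^-1` U); split=> // [|k].
  by apply: open_comp => // y _; exact: cL.
exact: Ck_comp_lin (sf k).
Qed.

Lemma smooth_at_coord V n (f : V -> 'rV[R]_n) (l : 'I_n) x :
  smooth_at f x -> smooth_at (fun y => f y 0 l : R) x.
Proof.
by move=> [U [oU Ux sf]]; exists U; split=> // k; exact: Ck_coord (sf k).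
Qed.

Lemma smooth_at_scalel V W (f : V -> R) (w : W) x :
  smooth_at f x -> smooth_at (fun y => f y *: w) x.
Proof.
by move=> [U [oU Ux sf]]; exists U; split=> // k; exact: Ck_scalel (sf k).
Qed.

Lemma smooth_at_scale V n (f : V -> R) (a : V -> 'rV[R]_n) x :
  smooth_at f x -> smooth_at a x -> smooth_at (fun y => f y *: a y) x.
Proof.
move=> sf sa.
(* Expanding [a] in the standard basis leaves only products of real functions multiplying fixed
   vectors. *)
have -> : (fun y => f y *: a y) =
    (fun y => \sum_l (f y * a y 0 l) *: delta_mx 0 l).
  apply/funext => y; rewrite [in LHS](row_sum_delta (a y)) scaler_sumr.
  by apply: eq_bigr => l _; rewrite scalerA.
apply: smooth_at_sum => l; apply: smooth_at_scalel; apply: smooth_atM => //.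
exact: smooth_at_coord.
Qed.

Lemma differential_linear V W (f : V -> W) x : linear (differential f x).
Proof. by move=> a u v; rewrite /differential linearP. Qed.

Lemma differential_near_eq V W (f g : V -> W) x :
  (\near x, f x = g x) -> differentiable f x ->
  differential f x = differential g x.
Proof. by move=> fg df; have [] := near_eq_is_diff fg df. Qed.

Lemma differential_sum V W n (f : 'I_n -> V -> W) x v :
  (forall i, differentiable (f i) x) ->
  differential (fun y => \sum_i f i y) x v = \sum_i differential (f i) x v.
Proof.
move=> df; rewrite /differential -deriveE.
  rewrite -fct_sumE derive_sum => [|i]; last exact: diff_derivable.
  by apply: eq_bigr => i _; rewrite deriveE.
by rewrite -fct_sumE; exact: differentiable_sum.
Qed.

Lemma differential_comp_lin V V' W (f : V -> W) (L : {linear V' -> V}) x v :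
  continuous L -> differentiable f (L x) ->
  differential (f \o L) x v = differential f (L x) (L v).
Proof.
move=> cL df; rewrite differential_comp //=; last exact: linear_differentiable.
by rewrite /differential [in X in _ (X v)]diff_lin.
Qed.

Lemma differential_lin V W W' (f : V -> W) (L : {linear W -> W'}) x v :
  continuous L -> differentiable f x ->
  differential (L \o f) x v = L (differential f x v).
Proof.
move=> cL df; rewrite differential_comp //=; last exact: linear_differentiable.
by rewrite /differential [in LHS]diff_lin.
Qed.

Lemma differential_coord V n (f : V -> 'rV[R]_n) x v l : differentiable f x ->
  differential (fun y => f y 0 l : R) x v = differential f x v 0 l.
Proof.
have lin : linear (fun y : 'rV[R]_n => y 0 l : R) by move=> a y z; rewrite !mxE.
pose M := GRing.isLinear.Build _ _ _ _ _ lin.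
pose L : {linear _ -> _} := HB.pack (fun y : 'rV[R]_n => y 0 l : R) M.
exact: (@differential_lin V _ _ f L x v (@linear_rV_continuous _ _ _ L)).
Qed.

(** Entry by entry, this is the product rule for real-valued functions. *)
Lemma differential_scale V n (f : V -> R) (a : V -> 'rV[R]_n) x v :
  smooth_at f x -> smooth_at a x ->
  differential (fun y => f y *: a y) x v =
  differential f x v *: a x + f x *: differential a x v.
Proof.
move=> sf sa; have da := smooth_at_differentiable sa.
have df := smooth_at_differentiable sf.
have dal l := smooth_at_differentiable (smooth_at_coord l sa).
apply/rowP => l; rewrite -differential_coord; last first.
  by apply: smooth_at_differentiable; exact: smooth_at_scale.
have -> : (fun y => (f y *: a y) 0 l) = (f * (fun y => a y 0 l : R)).
  by apply/funext => y; rewrite !mxE.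
rewrite [differential (f * _) x]diffM // !mxE -(differential_coord v l da).
by rewrite [RHS]addrC; congr (_ + _); exact: mulrC.
Qed.

Lemma smooth_at_line V (x v : V) (t : R) :
  smooth_at (fun s : R => x + s *: v) t.
Proof.
apply: smooth_atD; first exact: smooth_at_cst.
exact: smooth_at_scalel (smooth_at_id _).
Qed.

Lemma derive_line V (x v : V) (t : R) : 'D_1 (fun s : R => x + s *: v) t = v.
Proof.
have dl : differentiable ( *:%R ^~ v : R -> V) t.
  exact: smooth_at_differentiable (smooth_at_scalel _ (smooth_at_id _)).
rewrite (_ : (fun s => _) = cst x + ( *:%R ^~ v)) // deriveD //.
- rewrite derive_cst add0r deriveE //.
  by rewrite (@diff_val _ _ _ _ _ _ _ (is_diff_scalel t v)) scale1r.
- exact: diff_derivable.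
Qed.

End SmoothAt.

(** * Tangent vectors and vector fields in chart coordinates *)

Section TangentCoordinates.
Variables (R : realType) (n : nat) (N : smoothSpace R n).
Implicit Types (p : N) (i : chart_index N) (X Y : vfield N).

Lemma tchange_linear i i' p : linear (tchange i i' p).
Proof. exact: differential_linear. Qed.

Lemma tcoord_linear i p : linear (@tcoord R n N i p).
Proof. exact: tchange_linear. Qed.

Lemma tcoordZ i p a (v : tspace p) : tcoord i (a *: v) = a *: tcoord i v.
Proof. exact: (scalable_linear (@tcoord_linear i p)). Qed.

Lemma tvec_linear i p : linear (@tvec R n N i p).
Proof. exact: tchange_linear. Qed.

Lemma tcoordK i p (v : tspace p) : chart_dom i p -> tvec i p (tcoord i v) = v.
Proof.
by move=> ip; rewrite /tvec /tcoord tchange_comp ?tchange_id //;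
  exact: chart_dom_at.
Qed.

Lemma tvecK i p (x : 'rV[R]_n) : chart_dom i p -> tcoord i (tvec i p x) = x.
Proof.
by move=> ip; rewrite /tvec /tcoord tchange_comp ?tchange_id //;
  exact: chart_dom_at.
Qed.

Lemma tcoord_at p (v : tspace p) : tcoord (chart_at p) v = v.
Proof. exact/tchange_id/chart_dom_at. Qed.

Lemma tvec_at p x : tvec (chart_at p) p x = x.
Proof. exact/tchange_id/chart_dom_at. Qed.

Lemma near_chart_img i p : chart_dom i p ->
  \forall x \near chart i p, (chart i @` chart_dom i) x.
Proof.
by move=> ip; apply: near_open (@chart_img_open _ _ N i) _ _ => //; exists p.
Qed.

Lemma near_chart_dom i p : chart_dom i p -> \forall q \near p, chart_dom i q.
Proof.
by move=> ip; apply: open_nbhs_nbhs; split=> //; exact: chart_dom_open.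
Qed.

Lemma near_chartV i p (P : N -> Prop) : chart_dom i p ->
  (\forall q \near p, P q) -> \forall x \near chart i p, P (chartV i x).
Proof.
move=> ip nP; have ipx : (chart i @` chart_dom i) (chart i p) by exists p.
by apply: (chartV_continuous ipx); rewrite chartK.
Qed.

Definition vfield_coord i X (x : 'rV[R]_n) : 'rV[R]_n :=
  tcoord i (X (chartV i x)).

(** In the charts at [p], the section defined by [X] is the map sending [x] to the pair of [x] and
    [vfield_coord i X x]; its first half is the identity, so only the second carries a condition.
    Continuity into the tangent bundle is recovered from this local expression. *)
Lemma smooth_vfieldP X p : smooth_vfield_at X p <->
  smooth_at (vfield_coord (chart_at p) X) (chart (chart_at p) p).
Proof.
set i := chart_at p; have ip : chart_dom i p by exact: chart_dom_at.
split=> [[_ sX]|sX].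
  have := smooth_at_lin (@linear_rV_continuous _ _ _ rsubmx) sX.
  by apply: smooth_at_near_eq; apply: filterE => x /=; rewrite row_mxKr.
have sX' := smooth_at_row_mx (smooth_at_id (chart i p)) sX.
split.
  (* Near [p] the section factors as the chart, then [F], then the inverse bundle chart, each of
     them continuous at the relevant point. *)
  pose F x := row_mx x (vfield_coord i X x).
  have e : \forall q \near p, (@tangent_chartV _ _ N i \o (F \o chart i)) q
      = TPoint (X q).
    apply: filterS (near_chart_dom ip) => q iq /=; rewrite /F /vfield_coord.
    rewrite chartK //; exact: (@tangent_chartK _ _ N i (TPoint (X q))).
  change ((fun q => TPoint (X q) : tangent_bundle N) @ p -->
    (TPoint (X p) : tangent_bundle N)).
  rewrite -(nbhs_singleton e); apply: cvg_trans (near_eq_cvg e) _.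
  apply: continuous_comp; first apply: continuous_comp.
  - exact: chart_continuous.
  - exact: (smooth_at_continuous sX').
  - apply: tangent_chartV_continuous; rewrite tangent_chart_img /tangent_img /=.
    by rewrite row_mxKl; exists p.
apply: smooth_at_near_eq sX'; apply: filterS (near_chart_img ip) => x ix /=.
by rewrite /tangent_chart /= chartVK.
Qed.

Lemma smooth_vfield_at_near_eq X Y p : (\forall q \near p, X q = Y q) ->
  smooth_vfield_at X p -> smooth_vfield_at Y p.
Proof.
move=> XY /smooth_vfieldP sX; apply/smooth_vfieldP.
apply: smooth_at_near_eq sX.
apply: filterS (near_chartV (chart_dom_at p) XY) => x.
by rewrite /vfield_coord => ->.
Qed.

Lemma vfield_coordD i X Y :
  vfield_coord i (fun q => X q + Y q) =
  (fun x => vfield_coord i X x + vfield_coord i Y x).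
Proof.
apply/funext => x; rewrite /vfield_coord -[X _]scale1r tcoord_linear.
by rewrite !scale1r.
Qed.

Lemma vfield_coordZ i (f : N -> R) X :
  vfield_coord i (fun q => f q *: X q) =
  (fun x => f (chartV i x) *: vfield_coord i X x).
Proof.
apply/funext => x; exact: tcoordZ.
Qed.

Lemma smooth_vfieldD X Y p : smooth_vfield_at X p -> smooth_vfield_at Y p ->
  smooth_vfield_at (fun q => X q + Y q) p.
Proof.
move=> /smooth_vfieldP sX /smooth_vfieldP sY; apply/smooth_vfieldP.
by rewrite vfield_coordD; exact: smooth_atD.
Qed.

Lemma smooth_vfieldZ (f : N -> R) X p :
  smooth_fun_at f p -> smooth_vfield_at X p ->
  smooth_vfield_at (fun q => f q *: X q) p.
Proof.
move=> sf /smooth_vfieldP sX; apply/smooth_vfieldP.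
by rewrite vfield_coordZ; exact: smooth_at_scale.
Qed.

Lemma smooth_vfield0 p : smooth_vfield_at (fun q : N => 0) p.
Proof.
apply/smooth_vfieldP; apply: smooth_at_near_eq (smooth_at_cst 0 _).
apply: filterE => x; rewrite /vfield_coord.
(* The zero vector is written as a multiple by 0, so that homogeneity of [tcoord] yields zero
   coordinates. *)
rewrite -{2}(scale0r (0 : tspace (chartV (chart_at p) x))).
by rewrite tcoordZ scale0r.
Qed.

Lemma smooth_vfield_sum (I : Type) (r : seq I) (X : I -> vfield N) p :
  (forall l, smooth_vfield_at (X l) p) ->
  smooth_vfield_at (fun q => \sum_(l <- r) X l q) p.
Proof.
move=> sX; elim: r => [|l r IH].
  rewrite (_ : (fun q => _) = fun q : N => 0); first exact: smooth_vfield0.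
  by apply: functional_extensionality_dep => q; rewrite big_nil.
rewrite (_ : (fun q => _) = fun q : N => X l q + \sum_(l <- r) X l q).
  exact: smooth_vfieldD.
by apply: functional_extensionality_dep => q; rewrite big_cons.
Qed.

Lemma smooth_frame p k : smooth_vfield_at (frame (chart_at p) k) p.
Proof.
apply/smooth_vfieldP; apply: smooth_at_near_eq (smooth_at_cst (delta_mx 0 k) _).
apply: filterS (near_chart_img (chart_dom_at p)) => x ix.
by rewrite /vfield_coord /frame tvecK //; exact: chartV_dom.
Qed.

Lemma frame_at p k : frame (chart_at p) k p = delta_mx 0 k.
Proof. exact: tvec_at. Qed.

Lemma tvecE i p x : tvec i p x = \sum_k x 0 k *: frame i k p.
Proof. exact/linear_rVE/tvec_linear. Qed.

End TangentCoordinates.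

(** * Locality of a connection and its coordinate expression *)

Section Connection.
Variables (R : realType) (n : nat) (N : smoothSpace R n).
Variable D : forall p : N, tspace p -> vfield N -> tspace p.
Hypothesis connD : connection D.
Implicit Types (p : N) (X Y : vfield N).

(* If X vanishes near p then X = f X for the indicator f of [X <> 0], which is
   smooth at p because it vanishes near p; no bump function is needed. *)
Lemma connection_near0 p (v : tspace p) X :
  smooth_vfield_at X p -> (\forall q \near p, X q = 0) -> D v X = 0.
Proof.
move=> sX X0; pose f q : R := if `[< X q = 0 >] then 0 else 1.
have f0 : \forall q \near p, f q = 0.
  by apply: filterS X0 => q Xq; rewrite /f; case: asboolP.
have ip := chart_dom_at p.
have f0' : \forall x \near chart (chart_at p) p,
    (fun=> 0) x = (f \o chartV (chart_at p)) x.
  by apply: filterS (near_chartV ip f0) => x /= ->.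
have sf : smooth_fun_at f p := smooth_at_near_eq f0' (smooth_at_cst _ _).
have {1}-> : X = fun q => f q *: X q.
  apply: functional_extensionality_dep => q; rewrite /f.
  by case: asboolP => [->|_]; rewrite ?scaler0 ?scale1r.
rewrite connection_leibniz // (nbhs_singleton X0) scaler0 add0r.
by rewrite (nbhs_singleton f0) scale0r.
Qed.

(** Additivity reduces this to [connection_near0] for the difference of the fields, which is smooth
    at [p] because it agrees with the zero field nearby. *)
Lemma connection_near_eq p (v : tspace p) X Y : smooth_vfield_at X p ->
  (\forall q \near p, X q = Y q) -> D v X = D v Y.
Proof.
move=> sX XY; have sY := smooth_vfield_at_near_eq XY sX.
have sB : smooth_vfield_at (fun q => X q - Y q) p.
  apply: smooth_vfield_at_near_eq (smooth_vfield0 p).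
  by apply: filterS XY => q ->; rewrite subrr.
have {1}-> : X = fun q => Y q + (X q - Y q).
  by apply: functional_extensionality_dep => q; rewrite addrC subrK.
rewrite connection_add // [X in _ + X]connection_near0 ?addr0 //.
by apply: filterS XY => q ->; rewrite subrr.
Qed.

Lemma connection_sum (I : Type) (r : seq I) (X : I -> vfield N) p
    (v : tspace p) :
  (forall l, smooth_vfield_at (X l) p) ->
  D v (fun q => \sum_(l <- r) X l q) = \sum_(l <- r) D v (X l).
Proof.
move=> sX; elim: r => [|l r IH].
  rewrite big_nil; apply: connection_near0; first exact: smooth_vfield_sum.
  by apply: filterE => q; rewrite big_nil.
rewrite big_cons -IH -connection_add //; last exact: smooth_vfield_sum.
by congr (D v _); apply: functional_extensionality_dep => q; rewrite big_cons.
Qed.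

(** The Christoffel formula: [X] is expanded in the coordinate frame and the Leibniz rule is applied
    to each term. The derivatives of the coefficients assemble into the differential of
    [vfield_coord]. *)
Lemma connection_coord p (v : tspace p) X : smooth_vfield_at X p ->
  D v X = differential (vfield_coord (chart_at p) X) (chart (chart_at p) p) v +
    \sum_k (X p : 'rV[R]_n) 0 k *: D v (frame (chart_at p) k).
Proof.
move=> sX; set i := chart_at p; have ip : chart_dom i p by exact: chart_dom_at.
have /smooth_vfieldP sXc := sX; rewrite -/i in sXc.
pose f k q : R := tcoord i (X q) 0 k.
have sf k : smooth_fun_at (f k) p by exact: (smooth_at_coord k sXc).
have sfE k : smooth_vfield_at (fun q => f k q *: frame i k q) p.
  by apply: smooth_vfieldZ => //; exact: smooth_frame.
(* The expansion holds only on the chart domain; locality of [D] allows the replacement all the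
   same. *)
have XE : \forall q \near p, X q = \sum_k f k q *: frame i k q.
  by apply: filterS (near_chart_dom ip) => q iq; rewrite -tvecE tcoordK.
rewrite (connection_near_eq v sX XE) connection_sum //.
have dX := smooth_at_differentiable sXc.
rewrite [X in _ = X + _](row_sum_delta (differential _ _ v)) -big_split.
apply: eq_bigr => k _; rewrite connection_leibniz //; last exact: smooth_frame.
(* At [p] itself the chart [chart_at p] is the one presenting the tangent space, so the frame is the
   standard basis and the coefficients are the entries of [X p]. *)
rewrite frame_at -(differential_coord v k dX) /deriv_along.
by rewrite /f tcoord_at.
Qed.

End Connection.

(** * Coordinate formulas for [Pi_map] and [K_map] *)

Section KMap.
Variables (R : realType) (n : nat) (N : smoothSpace R n).
Variable D : forall p : N, tspace p -> vfield N -> tspace p.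
Implicit Types u : tangent_bundle N.

(** Near [u] the bundle projection reads in charts as the linear map [lsubmx], which is its own
    differential. *)
Lemma Pi_mapE u (X : tspace u) : Pi_map X = lsubmx (X : 'rV[R]_(n + n)).
Proof.
rewrite /Pi_map /mdiff; set i := chart_at (base u).
have iu : chart_dom i (base u) by exact: chart_dom_at.
set z := chart _ u; have zE : lsubmx z = chart i (base u) by exact: row_mxKl.
have cl : continuous (@lsubmx R 1 n n) by exact: linear_rV_continuous.
have e : \forall y \near z,
    lsubmx y = (chart i \o (fun u => base u) \o @tangent_chartV _ _ N i) y.
  have ix : \forall x \near lsubmx z, (chart i @` chart_dom i) x.
    by rewrite zE; exact: near_chart_img.
  have iy : \forall y \near z, (chart i @` chart_dom i) (lsubmx y).
    exact: (cl z _ ix).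
  by apply: filterS iy => y /= iy; rewrite chartVK.
rewrite -(differential_near_eq e); last exact: linear_differentiable.
by rewrite /differential diff_lin.
Qed.

(* The curve enters only through its velocity, so [K_map] is well defined. *)
Lemma cov_derivE (a : R -> tangent_bundle N) t : smooth_curve_at a t ->
  let X : 'rV[R]_(n + n) := velocity a t in
  cov_deriv D a t = rsubmx X + \sum_k (vec (a t) : 'rV[R]_n) 0 k *:
    D (lsubmx X : tspace (base (a t))) (frame (chart_at (base (a t))) k).
Proof.
move=> [_ sa] X; rewrite /cov_deriv; set i := chart_at (base (a t)).
have cl : continuous (@lsubmx R 1 n n) by exact: linear_rV_continuous.
have cr : continuous (@rsubmx R 1 n n) by exact: linear_rV_continuous.
have da := smooth_at_differentiable sa.
have XE : X = differential (chart (chart_at (a t)) \o a) t 1.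
  by rewrite /X /velocity deriveE.
have velE : velocity (fun s => base (a s)) t = lsubmx X.
  rewrite XE -differential_lin // /velocity /differential -deriveE.
    congr ('D_1 _ t); apply/funext => s /=.
    by rewrite /tangent_chart row_mxKl.
  by apply: smooth_at_differentiable; exact: smooth_at_lin.
have vecE : (fun s => tcoord i (vec (a s))) =
    rsubmx \o (chart (chart_at (a t)) \o a).
  apply/funext => s /=.
  by rewrite /tangent_chart row_mxKr.
have sV : smooth_at (fun s => tcoord i (vec (a s))) t.
  by rewrite vecE; exact: smooth_at_lin.
rewrite velE [rsubmx X]row_sum_delta -big_split.
apply: eq_bigr => k _; rewrite frame_at tcoord_at; congr (_ *: _ + _).
rewrite deriveE; last first.
  by apply: smooth_at_differentiable; exact: smooth_at_coord.
apply: etrans (differential_coord _ k (smooth_at_differentiable sV)) _.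
by rewrite vecE differential_lin // XE.
Qed.

Lemma exists_curve u (X : tspace u) : exists a : R -> tangent_bundle N,
  [/\ smooth_curve_at a 0, a 0 = u & velocity a 0 = X].
Proof.
set i := chart_at u; have iu : chart_dom i u by exact: chart_dom_at.
have ux : (chart i @` chart_dom i) (chart i u) by exists u.
(* The curve is a straight line in the chart with direction [X]. It is known to stay in the chart
   image only for [s] near 0, which suffices for its germ. *)
pose c (s : R) : 'rV[R]_(n + n) := chart i u + s *: (X : 'rV[R]_(n + n)).
have c0 : c 0 = chart i u by rewrite /c scale0r addr0.
have sc : smooth_at c 0 by exact: smooth_at_line.
have cc := smooth_at_continuous sc.
pose a s := chartV i (c s); have a0 : a 0 = u by rewrite /a c0 chartK.
have e : \forall s \near (0 : R), c s = (chart i \o a) s.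
  have ix : \forall x \near c 0, (chart i @` chart_dom i) x.
    by rewrite c0; exact: near_chart_img.
  have is0 : \forall s \near (0 : R), (chart i @` chart_dom i) (c s).
    exact: (cc _ ix).
  by apply: filterS is0 => s icx; exact: esym (chartVK icx).
exists a; split=> //.
  split; last by rewrite a0; exact: smooth_at_near_eq sc.
  apply: continuous_comp; first exact: cc.
  by rewrite c0; exact: chartV_continuous.
rewrite /velocity a0 -(near_eq_derive _ e).
exact: derive_line.
Qed.

(** Some curve has velocity [X] by [exists_curve], and by [cov_derivE] all such curves give this
    same value; so [xget] selects it and never its default 0. *)
Lemma K_mapE u (X : tspace u) : K_map D X =
  rsubmx (X : 'rV[R]_(n + n)) + \sum_k (vec u : 'rV[R]_n) 0 k *:
    D (Pi_map X) (frame (chart_at (base u)) k).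
Proof.
rewrite Pi_mapE; apply: xget_unique => [|w [a [sa a0 aX <-]]].
  have [a [sa a0 aX]] := exists_curve X; exists a; split=> //.
  subst u X; exact: (cov_derivE sa).
subst u X; exact: (cov_derivE sa).
Qed.

End KMap.

(** * The bundle map induced by a parallel endomorphism field *)

Section BundleMap.
Variables (R : realType) (n : nat) (N : smoothSpace R n).
Variable D : forall p : N, tspace p -> vfield N -> tspace p.
Hypothesis connD : connection D.
Variable J : forall p : N, tspace p -> tspace p.
Hypothesis J_linear : forall p, linear (@J p).
Hypothesis J_smooth : forall p (X : vfield N),
  smooth_vfield_at X p -> smooth_vfield_at (fun q => J (X q)) p.
Hypothesis J_parallel : forall p (v : tspace p) (X : vfield N),
  smooth_vfield_at X p -> D v (fun q => J (X q)) = J (D v X).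
Implicit Types (u : tangent_bundle N) (i : chart_index N).

Definition fibre_map u : tangent_bundle N := TPoint (J (vec u)).

(** The [k]-th row of the matrix of [J] in chart [i], as a function of the chart point. *)
Let J_frame i k : 'rV[R]_n -> 'rV[R]_n :=
  vfield_coord i (fun q => J (frame i k q)).

Let fibre_map_coord i (z : 'rV[R]_(n + n)) : 'rV[R]_(n + n) :=
  row_mx (lsubmx z) (\sum_k rsubmx z 0 k *: J_frame i k (lsubmx z)).

Let cl : continuous (@lsubmx R 1 n n).
Proof. exact: linear_rV_continuous. Qed.

Let cr : continuous (@rsubmx R 1 n n).
Proof. exact: linear_rV_continuous. Qed.

Lemma fibre_map_coordE i z : @tangent_img _ _ N i z ->
  tangent_chart i (fibre_map (tangent_chartV i z)) = fibre_map_coord i z.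
Proof.
move=> iz; rewrite /tangent_chart /= chartVK //; congr row_mx.
have lin : linear
    (fun x => tcoord i (J (tvec i (chartV i (lsubmx z)) x)) : 'rV[R]_n).
  by move=> a x y; rewrite tvec_linear J_linear tcoord_linear.
exact: (linear_rVE (rsubmx z) lin).
Qed.

(** As [fibre_map] fixes base points, the chart chosen at the image of [u] is the one chosen at [u].
    The right-hand side is thus the local expression that [smooth_map_at] and [mdiff] use, and
    [fibre_map_coord] can stand in for it. *)
Lemma near_fibre_map_coord u (i := chart_at (base u)) :
  \forall z \near tangent_chart i u, fibre_map_coord i z =
    (@tangent_chart _ _ N i \o fibre_map \o @tangent_chartV _ _ N i) z.
Proof.
have zi : @tangent_img _ _ N i (tangent_chart i u).
  rewrite /tangent_img /= row_mxKl; exists (base u) => //.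
  exact: chart_dom_at.
apply: near_open (@tangent_img_open _ _ N i) _ zi => z iz.
by rewrite /= fibre_map_coordE.
Qed.

Lemma smooth_at_J_frame p k :
  smooth_at (J_frame (chart_at p) k) (chart (chart_at p) p).
Proof. exact/smooth_vfieldP/J_smooth/smooth_frame. Qed.

Lemma smooth_fibre_map_term u k (i := chart_at (base u)) :
  smooth_at (fun z : 'rV[R]_(n + n) => rsubmx z 0 k : R) (tangent_chart i u) /\
  smooth_at (J_frame i k \o lsubmx) (tangent_chart i u).
Proof.
split.
  apply: smooth_at_coord.
  exact: (@smooth_at_lin _ _ _ _ id rsubmx _ cr (smooth_at_id _)).
apply: smooth_at_comp_lin; first exact: cl.
by rewrite /= row_mxKl; exact: smooth_at_J_frame.
Qed.

Lemma smooth_fibre_map_coord u (i := chart_at (base u)) :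
  smooth_at (fibre_map_coord i) (tangent_chart i u).
Proof.
apply: smooth_at_row_mx.
  exact: (@smooth_at_lin _ _ _ _ id lsubmx _ cl (smooth_at_id _)).
apply: smooth_at_sum => k; have [sk sJ] := smooth_fibre_map_term u k.
exact: smooth_at_scale sk sJ.
Qed.

Lemma smooth_fibre_map u : smooth_map_at fibre_map u.
Proof.
set i := chart_at (base u); have iu : tangent_dom i u by exact: chart_dom_at.
have sF :=
  smooth_at_near_eq (near_fibre_map_coord u) (smooth_fibre_map_coord u).
split; last exact: sF.
(* Continuity on the bundle follows from that of the local expression by composing with the charts,
   which cancel near [u]. *)
have e : \forall w \near (u : tangent_bundle N),
    ((@tangent_chartV _ _ N i \o (@tangent_chart _ _ N i \o fibre_map \o
      @tangent_chartV _ _ N i)) \o @tangent_chart _ _ N i) w = fibre_map w.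
  apply: filterS (near_chart_dom (N := tangent_bundle N) iu) => w iw /=.
  by rewrite tangent_chartK // tangent_chartK.
change (fibre_map @ u --> fibre_map u).
rewrite -(nbhs_singleton e); apply: cvg_trans (near_eq_cvg e) _.
apply: continuous_comp; first exact: (@tangent_chart_continuous _ _ N i u iu).
apply: continuous_comp; first exact: (smooth_at_continuous sF).
apply: tangent_chartV_continuous; rewrite /= tangent_chartK //.
by exists (fibre_map u).
Qed.

(** The base half is unchanged. On the fibre half the product rule gives two terms per index: one
    differentiates the fibre coordinate, the other the matrix row [J_frame i k] along the base
    direction. *)
Lemma mdiff_fibre_map u (X : tspace u) (i := chart_at (base u))
    (Y : 'rV[R]_(n + n) := mdiff fibre_map X) (Z : 'rV[R]_(n + n) := X) :
  lsubmx Y = lsubmx Z /\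
  rsubmx Y = \sum_k (rsubmx Z 0 k *: J_frame i k (chart i (base u)) +
    (vec u : 'rV[R]_n) 0 k *:
      differential (J_frame i k) (chart i (base u)) (lsubmx Z)).
Proof.
have sF := smooth_fibre_map_coord u; have dF := smooth_at_differentiable sF.
have -> : Y = differential (fibre_map_coord i) (tangent_chart i u) Z.
  by rewrite (differential_near_eq (near_fibre_map_coord u)).
have dl :=
  @linear_differentiable _ _ _ (@lsubmx R 1 n n) (tangent_chart i u) cl.
have dr :=
  @linear_differentiable _ _ _ (@rsubmx R 1 n n) (tangent_chart i u) cr.
split; rewrite -differential_lin //.
  rewrite (_ : lsubmx \o _ = lsubmx); last first.
    by apply/funext => z; rewrite /= row_mxKl.
  by rewrite /differential diff_lin.
rewrite (_ : rsubmx \o _ = fun z : 'rV[R]_(n + n) =>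
    \sum_k rsubmx z 0 k *: (J_frame i k \o lsubmx) z); last first.
  by apply/funext => z; rewrite /= row_mxKr.
have sk k := (smooth_fibre_map_term u k).1.
have sJ k := (smooth_fibre_map_term u k).2.
rewrite differential_sum => [|k]; last first.
  by apply: smooth_at_differentiable; exact: smooth_at_scale (sk k) (sJ k).
apply: eq_bigr => k _; rewrite (differential_scale _ (sk k) (sJ k)).
rewrite (differential_coord _ _ dr) [differential rsubmx _]diff_lin //.
have dJ : differentiable (J_frame i k) (lsubmx (tangent_chart i u)).
  rewrite /= row_mxKl; apply: smooth_at_differentiable.
  exact: smooth_at_J_frame.
rewrite (differential_comp_lin _ cl dJ) /= row_mxKl row_mxKr.
by rewrite tcoord_at.
Qed.

Lemma Pi_fibre_map u (X : tspace u) : Pi_map (mdiff fibre_map X) = Pi_map X.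
Proof. by rewrite !Pi_mapE (mdiff_fibre_map X).1. Qed.

Lemma K_fibre_map u (X : tspace u) :
  K_map D (mdiff fibre_map X) = J (K_map D X).
Proof.
rewrite !K_mapE Pi_fibre_map (mdiff_fibre_map X).2.
set p := base u; set i := chart_at p.
have ip : chart_dom i p by exact: chart_dom_at.
set v : tspace p := Pi_map X; set y := vec u; set Z := rsubmx _.
have vE : lsubmx (X : 'rV[R]_(n + n)) = v by rewrite /v Pi_mapE.
pose E l : 'rV[R]_n := D v (frame i l).
pose e k : 'rV[R]_n := J (delta_mx 0 k : tspace p).
pose d k : 'rV[R]_n := differential (J_frame i k) (chart i p) v.
have JE (x : 'rV[R]_n) : J (x : tspace p) = \sum_k x 0 k *: e k.
  exact: (linear_rVE x (@J_linear p)).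
(* Parallelism enters here: [J] applied to the derivative of a frame field is the derivative of its
   image under [J], expanded by [connection_coord]. *)
have JEk k : J (E k : tspace p) = d k + \sum_l e k 0 l *: E l.
  rewrite /E -J_parallel; last exact: smooth_frame.
  rewrite connection_coord //; last exact/J_smooth/smooth_frame.
  by rewrite frame_at.
have eE k : J_frame i k (chart i p) = e k.
  by rewrite /J_frame /vfield_coord chartK // tcoord_at frame_at.
pose JM := GRing.isLinear.Build _ _ _ _ _ (@J_linear p).
pose L : {linear 'rV[R]_n -> 'rV[R]_n} := HB.pack (@J p) JM.
have -> : J (Z + \sum_k (y : 'rV[R]_n) 0 k *: E k : tspace p) =
    \sum_k Z 0 k *: e k +
    \sum_k (y : 'rV[R]_n) 0 k *: (d k + \sum_l e k 0 l *: E l).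
  change (L (Z + \sum_k (y : 'rV[R]_n) 0 k *: E k) = \sum_k Z 0 k *: e k +
    \sum_k (y : 'rV[R]_n) 0 k *: (d k + \sum_l e k 0 l *: E l)).
  rewrite linearD linear_sum [L Z]JE; congr (_ + _).
  by apply: eq_bigr => k _; rewrite linearZ -JEk.
rewrite (_ : vec (fibre_map u) = J y) // vE [J y]JE.
under eq_bigr do rewrite eE.
rewrite big_split -addrA; congr (_ + _).
(* What remains is to match the coefficients of each [E l]: on the left it is the [l]-th entry of
   [J y], on the right it appears after exchanging the double sum. *)
under [RHS]eq_bigr do rewrite scalerDr scaler_sumr.
rewrite big_split; congr (_ + _); rewrite exchange_big.
apply: eq_bigr => l _; rewrite summxE scaler_suml.
by apply: eq_bigr => k _; rewrite mxE scalerA.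
Qed.

End BundleMap.

(** * The isometry between the two metrics *)

Theorem proposition5 (R : realType) (n : nat) (N : smoothSpace R n)
  (hN : is_manifold N)
  (j : forall p : N, tspace p -> tspace p)
  (g : forall p : N, tspace p -> tspace p -> R)
  (D : forall p : N, tspace p -> vfield N -> tspace p)
  (hK : kaehler j g D) :
  exists f : tangent_bundle N -> tangent_bundle N,
    diffeomorphism f /\
    forall (u : tangent_bundle N) (X Y : tspace u),
      pullback f (G_metric D g) X Y = GG_metric D g j X Y.
Proof.
have [hg [connD _ _] jlin jj jsm jg jpar] := hK.
(* Writing -j as j^3 makes its smoothness and parallelism those of j. *)
pose J p (v : tspace p) : tspace p := j p (j p (j p v)).
have Jlin p : linear (@J p) by move=> a v w; rewrite /J !jlin.
have Jsm p (X : vfield N) :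
    smooth_vfield_at X p -> smooth_vfield_at (fun q => J q (X q)) p.
  by move=> sX; apply: (jsm); apply: (jsm); exact: jsm.
have Jpar p (v : tspace p) (X : vfield N) :
    smooth_vfield_at X p -> D p v (fun q => J q (X q)) = J p (D p v X).
  move=> sX; rewrite /J -!jpar //; by do ?apply: (jsm).
exists (fibre_map J); split.
  (* The inverse is induced by [j] itself, since the fourth power of [j] is the identity. *)
  exists (fibre_map j); split=> [[p v]|[p v]|p|p].
  - by rewrite /fibre_map /J /= !jj opprK.
  - by rewrite /fibre_map /J /= !jj opprK.
  - exact: smooth_fibre_map.
  - exact: smooth_fibre_map.
have gN p (v w : tspace p) : g p (- v) w = - g p v w.
  have g0 : g p 0 w = 0.
    by rewrite -(addNr v) -scaleN1r (metric_linear hg) mulN1r addNr.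
  by rewrite -[- v]addr0 -scaleN1r (metric_linear hg) mulN1r g0 addr0.
(* Skew-adjointness of [j]: orthogonality replaces both arguments by their images under [j], and the
   square of [j] is minus the identity. *)
have jN_adj p (v w : tspace p) : g p (- j p v) w = g p v (j p w).
  by rewrite gN -jg jj gN opprK.
move=> u X Y; rewrite /pullback /G_metric /GG_metric.
have KJ := K_fibre_map connD Jlin Jsm Jpar.
rewrite !Pi_fibre_map // !KJ.
(* The base point of [fibre_map J u] computes to [base u], so both metrics are compared in one
   tangent space, where [J] simplifies to minus [j]. *)
change (g (base u) (Pi_map X) (J (base u) (K_map D Y)) +
    g (base u) (J (base u) (K_map D X)) (Pi_map Y) =
  g (base u) (K_map D X) (j (base u) (Pi_map Y)) -
    g (base u) (Pi_map X) (j (base u) (K_map D Y))).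
by rewrite /J !jj jN_adj (Defs.metric_sym hg (Pi_map X) (- _)) gN
  (Defs.metric_sym hg (j _ _)) addrC.
Qed.
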